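(* Let $f:\overline{(U,E)}\to\overline{(V,E')}$, $g:\overline{(V,E')}\to\overline{(W,E'')}$ and $h:\overline{(W,E'')}\to\overline{(X,E''')}$ be three hesitant fuzzy soft mappings. Then $h\circ(g\circ f)=(h\circ g)\circ f$.
   Context: All universes ($U,V,W,X$) and attribute (parameter) sets ($E,E',E'',E'''$) are nonempty sets. A hesitant fuzzy element (HFE) is a nonempty subset of $[0,1]$. A hesitant fuzzy set on $U$ assigns to each $x\in U$ an HFE. A hesitant fuzzy soft set $F_A$ over $U$ with attributes from $E$ is given by a nonempty $A\subseteq E$ and, for each $e\in A$, a hesitant fuzzy set $F(e)$ on $U$; write $F_A(e)(x)$ for the HFE of $x\in U$ at $e$. By convention $F_A(e)(x)=\{0\}$ for $e\in E\setminus A$, and two hesitant fuzzy soft sets over $U$ with attributes from $E$ are equal when they agree as functions of $(e,x)\in E\times U$. The hesitant fuzzy soft class $\overline{(U,E)}$ is the collection of all hesitant fuzzy soft sets over $U$ with attributes from $E$. The union of HFEs is $\mu_1\cup\mu_2=\{\max(\gamma_1,\gamma_2):\gamma_1\in\mu_1,\gamma_2\in\mu_2\}$; for a nonempty family, $\bigcup_i\mu_i=\{\sup_i\gamma_i:\gamma_i\in\mu_i \text{ for all } i\}$ (so the maximum for finite families), and the union of the empty family is $\{0\}$. Given maps $p:U\to V$ and $q:E\to E'$, the hesitant fuzzy soft mapping $f=(p,q):\overline{(U,E)}\to\overline{(V,E')}$ sends $F_A$ to its image $f(F_A)$ defined, for $\beta\in E'$ and $y\in V$, by $f(F_A)(\beta)(y)=\bigcup_{\alpha\in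 q^{-1}(\beta)\cap A,\ s\in p^{-1}(y)}F_A(\alpha)(s)$. Two hesitant fuzzy soft mappings are equal when they are equal as mappings between classes. The composite $g\circ f$ of $f=(p,q):\overline{(U,E)}\to\overline{(V,E')}$ and $g=(r,t):\overline{(V,E')}\to\overline{(W,E'')}$ is the hesitant fuzzy soft mapping $\overline{(U,E)}\to\overline{(W,E'')}$ satisfying $(g\circ f)(F_A)=g(f(F_A))$ for every $F_A\in\overline{(U,E)}$; its underlying pair of maps is $(r\circ p,\,t\circ q)$. *)

(* Defs.v *)
From mathcomp Require Import all_boot all_order all_algebra.
From mathcomp Require Import all_classical all_reals.

Set Implicit Arguments.
Unset Strict Implicit.
Unset Printing Implicit Defensive.

Import Order.TTheory GRing.Theory Num.Theory.

Local Open Scope classical_set_scope.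
Local Open Scope ring_scope.

Record hfe (R : realType) := HFE {
  hfe_set :> set R;
  hfe_neq0 : hfe_set !=set0;
  hfe_sub01 : hfe_set `<=` [set x | 0 <= x <= 1]
}.

(* The values of a selection [gamma] outside [J] play no role.  For empty [J]
   the result is [[set 0]], since [sup set0 = 0] (see [hfe_bigcup_set0]). *)
Definition hfe_bigcup (R : realType) (I : Type) (J : set I) (mu : I -> set R) :
    set R :=
  [set sup (gamma @` J) |
     gamma in [set gamma : I -> R | forall i, J i -> mu i (gamma i)]].

Section HfeBigcup.
Variable R : realType.
Implicit Types (S : set R).

Let sub01 S := S `<=` [set x | 0 <= x <= 1].

Lemma sup01_ub S x : sub01 S -> S x -> x <= sup S.
Proof.
move=> S01 Sx; apply: sup_upper_bound => //; split; first by exists x.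
by exists 1 => y /S01 /andP[].
Qed.

Lemma sup01_le S m : 0 <= m -> (forall x, S x -> x <= m) -> sup S <= m.
Proof.
move=> m0 Sm; have [->|S0] := eqVneq S set0; first by rewrite sup0.
by apply: ge_sup => //; apply/set0P.
Qed.

Lemma sup01_ge0 S : sub01 S -> 0 <= sup S.
Proof.
move=> S01; have [->|/set0P[x Sx]] := eqVneq S set0; first by rewrite sup0.
by apply: le_trans (sup01_ub S01 Sx); have /andP[] := S01 _ Sx.
Qed.

Lemma hfe_bigcup_set0 (I : Type) (mu : I -> set R) :
  hfe_bigcup set0 mu = [set 0].
Proof.
apply/seteqP; split=> [_ [gamma _ <-]|_ ->] /=; first by rewrite image_set0 sup0.
by exists (fun=> 0) => //; rewrite image_set0 sup0.
Qed.

Variables (I : Type) (mu : I -> set R).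

Lemma sel_sub01 (J : set I) (gamma : I -> R) :
  (forall i, J i -> sub01 (mu i)) -> (forall i, J i -> mu i (gamma i)) ->
  sub01 (gamma @` J).
Proof. by move=> mu01 Jg _ [i Ji <-]; apply: mu01 (Jg i Ji). Qed.

Lemma hfe_bigcup_sub01 (J : set I) :
  (forall i, J i -> sub01 (mu i)) -> sub01 (hfe_bigcup J mu).
Proof.
move=> mu01 _ [gamma Jg <-] /=; have g01 := sel_sub01 mu01 Jg.
rewrite sup01_ge0 //=; apply: sup01_le => // x /g01 /andP[]//.
Qed.

Lemma hfe_bigcup_neq0 (J : set I) :
  (forall i, J i -> mu i !=set0) -> hfe_bigcup J mu !=set0.
Proof.
move=> mu0; have /choice[gamma Jg] : forall i, exists x, J i -> mu i x.
  move=> i; have [/mu0[x mux]|nJ] := pselect (J i); first by exists x.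
  by exists 0.
by exists (sup (gamma @` J)); exists gamma.
Qed.

Lemma hfe_bigcup_widen (J J' : set I) :
  (forall i, J' i -> sub01 (mu i)) -> J `<=` J' ->
  (forall i, J' i -> ~ J i -> mu i = [set 0]) ->
  hfe_bigcup J mu = hfe_bigcup J' mu.
Proof.
move=> mu01 JJ' mu0.
have supE (g g' : I -> R) : (forall i, J' i -> mu i (g' i)) ->
    (forall i, J i -> g i = g' i) -> sup (g' @` J') = sup (g @` J).
  move=> J'g' gg'; have g'01 := sel_sub01 mu01 J'g'.
  have g01 : sub01 (g @` J).
    by move=> _ [i Ji <-]; rewrite gg' //; apply: g'01; exists i => //; apply: JJ'.
  apply/eqP; rewrite eq_le; apply/andP; split; apply: sup01_le; rewrite ?sup01_ge0 //.
    move=> _ [i J'i <-]; have [Ji|nJi] := pselect (J i).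
      by apply: sup01_ub => //; exists i => //; apply: gg'.
    by move: (J'g' _ J'i); rewrite mu0 // => ->; apply: sup01_ge0.
  move=> _ [i Ji <-]; apply: sup01_ub => //; exists i; first exact: JJ'.
  by rewrite gg'.
apply/seteqP; split=> _ [g Jg <-]; last first.
  by exists g => [i /JJ'/Jg//|]; apply/esym/supE.
pose g' i := if pselect (J i) then g i else 0.
have J'g' i : J' i -> mu i (g' i).
  by rewrite /g'; case: pselect => [/Jg//|nJ J'i] /=; rewrite mu0.
by exists g' => //; apply: supE => // i Ji; rewrite /g'; case: pselect.
Qed.

Lemma hfe_bigcup_nested (I' : Type) (f : I -> I') (J : set I) (J' : set I')
    (K : I' -> set I) :
  (forall i, J i -> sub01 (mu i)) ->
  (forall i, J i -> J' (f i)) ->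
  (forall j i, J' j -> K j i <-> J i /\ f i = j) ->
  hfe_bigcup J mu = hfe_bigcup J' (fun j => hfe_bigcup (K j) mu).
Proof.
move=> mu01 JJ' KP.
have KJ j i : J' j -> K j i -> J i by move=> J'j /(KP _ _ J'j)[].
have JK i : J i -> K (f i) i by move=> Ji; apply/KP => //; apply: JJ'.
have supE (g : I -> R) (d : I' -> R) : (forall i, J i -> mu i (g i)) ->
    (forall j, J' j -> d j = sup (g @` K j)) -> sup (g @` J) = sup (d @` J').
  move=> Jg dE; have g01 := sel_sub01 mu01 Jg.
  have gK01 j : J' j -> sub01 (g @` K j).
    by move=> J'j _ [i /(KJ _ _ J'j) Ji <-]; apply: g01; exists i.
  have d01 : sub01 (d @` J').
    move=> _ [j J'j <-] /=; rewrite dE // sup01_ge0; last exact: gK01.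
    by apply: sup01_le => // x /(gK01 _ J'j) /andP[].
  apply/eqP; rewrite eq_le; apply/andP; split; apply: sup01_le; rewrite ?sup01_ge0 //.
    move=> _ [i Ji <-]; apply: (@le_trans _ _ (d (f i))).
      rewrite dE; last exact: JJ'.
      by apply: sup01_ub; [exact/gK01/JJ'|exists i => //; exact: JK].
    by apply: sup01_ub => //; exists (f i) => //; exact: JJ'.
  move=> _ [j J'j <-]; rewrite dE //; apply: sup01_le; rewrite ?sup01_ge0 //.
  by move=> _ [i /(KJ _ _ J'j) Ji <-]; apply: sup01_ub => //; exists i.
apply/seteqP; split=> _ [g Jg <-].
  exists (fun j => sup (g @` K j)); last exact/esym/supE.
  by move=> j J'j; exists g => // i /(KJ _ _ J'j); apply: Jg.
have /choice[G GP] : forall j, exists d : I -> R, J' j ->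
    (forall i, K j i -> mu i (d i)) /\ sup (d @` K j) = g j.
  move=> j; have [/Jg[d dK dE]|nJ'] := pselect (J' j); first by exists d.
  by exists (fun=> 0).
have JG i : J i -> mu i (G (f i) i).
  by move=> Ji; have [+ _] := GP _ (JJ' _ Ji); apply; exact: JK.
exists (fun i => G (f i) i) => //; apply: supE => // j J'j.
have [_ <-] := GP _ J'j; congr sup; apply: eq_imagel => i Kji.
by have [_ ->] := (KP j i J'j).1 Kji.
Qed.

End HfeBigcup.

(* [hfs_fun] is total: it takes the conventional value {0} at the parameters
   outside [hfs_attr]. *)
Record hfs_set (R : realType) (U E : Type) := HFSSet {
  hfs_attr : set E;
  hfs_fun :> E -> U -> hfe R;
  hfs_attr_neq0 : hfs_attr !=set0;
  hfs_out : forall e x, ~ hfs_attr e -> hfs_fun e x = [set 0] :> set R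
}.

(* Equality of hesitant fuzzy soft sets; the attribute sets may differ. *)
Definition hfs_eq (R : realType) (U E : Type) (F G : hfs_set R U E) : Prop :=
  forall e x, F e x = G e x :> set R.

Section HfsImage.
Variables (R : realType) (U E V E' : Type) (p : U -> V) (q : E -> E').
Variable F : hfs_set R U E.

Definition hfs_image_index (b : E') (y : V) : set (E * U) :=
  (q @^-1` [set b] `&` hfs_attr F) `*` (p @^-1` [set y]).

Definition hfs_image_val (b : E') (y : V) : set R :=
  hfe_bigcup (hfs_image_index b y) (fun i => F i.1 i.2 : set R).

Lemma hfs_image_val_neq0 b y : hfs_image_val b y !=set0.
Proof. by apply: hfe_bigcup_neq0 => i _; apply: hfe_neq0. Qed.

Lemma hfs_image_val_sub01 b y :
  hfs_image_val b y `<=` [set x | 0 <= x <= 1].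
Proof. by apply: hfe_bigcup_sub01 => i _; apply: hfe_sub01. Qed.

Definition hfs_image_fun (b : E') (y : V) : hfe R :=
  HFE (hfs_image_val_neq0 b y) (@hfs_image_val_sub01 b y).

Lemma hfs_image_attr_neq0 : q @` hfs_attr F !=set0.
Proof. by have [e Ae] := hfs_attr_neq0 F; exists (q e); exists e. Qed.

Lemma hfs_image_out b y :
  ~ (q @` hfs_attr F) b -> hfs_image_fun b y = [set 0] :> set R.
Proof.
move=> nb; rewrite /= /hfs_image_val.
suff -> : hfs_image_index b y = set0 by exact: hfe_bigcup_set0.
by apply/seteqP; split=> // -[e x] [[/= qe Ae] _]; apply: nb; exists e.
Qed.

(* The image gets the attribute set [q(A)]; outside of it every union above is
   over the empty family, so its values are {0} there. *)
Definition hfs_image : hfs_set R V E' :=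
  HFSSet hfs_image_attr_neq0 hfs_image_out.

End HfsImage.

(* [R] is a parameter only so that a mapping can be applied to hesitant fuzzy
   soft sets with membership degrees in [R]. *)
Record hfs_mapping (R : realType) (U E V E' : Type) := HFSMapping {
  hfs_univ_map : U -> V;
  hfs_attr_map : E -> E'
}.

Definition hfs_apply (R : realType) (U E V E' : Type)
    (f : hfs_mapping R U E V E') (F : hfs_set R U E) : hfs_set R V E' :=
  hfs_image (hfs_univ_map f) (hfs_attr_map f) F.

Coercion hfs_apply : hfs_mapping >-> Funclass.

(* [hfs_apply f] is a mapping between classes, in which sets are identified up
   to [hfs_eq]. *)
Lemma hfs_apply_eq (R : realType) (U E V E' : Type)
    (f : hfs_mapping R U E V E') (F G : hfs_set R U E) :
  hfs_eq F G -> hfs_eq (f F) (f G).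
Proof.
move=> FG b y.
have widen (H : hfs_set R U E) : f H b y = hfe_bigcup
    ((hfs_attr_map f @^-1` [set b]) `*` (hfs_univ_map f @^-1` [set y]))
    (fun i => H i.1 i.2 : set R) :> set R.
  apply: hfe_bigcup_widen => [i _|[e x] [[? ?] ?]|[e x] [qe px] nH] /=.
  - exact: hfe_sub01.
  - by [].
  - by apply: hfs_out => He; apply: nH.
by rewrite !widen; congr hfe_bigcup; apply/funext => i; apply: FG.
Qed.

(* Equality of hesitant fuzzy soft mappings is equality of the mappings they
   induce between classes, not of their underlying pairs. *)
Definition hfs_mapping_eq (R : realType) (U E V E' : Type)
    (f g : hfs_mapping R U E V E') : Prop :=
  forall F : hfs_set R U E, hfs_eq (f F) (g F).

Definition is_hfs_comp (R : realType) (U E V E' W E'' : Type)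
    (g : hfs_mapping R V E' W E'') (f : hfs_mapping R U E V E')
    (k : hfs_mapping R U E W E'') : Prop :=
  [/\ forall F : hfs_set R U E, hfs_eq (k F) (g (f F)),
      hfs_univ_map k = hfs_univ_map g \o hfs_univ_map f &
      hfs_attr_map k = hfs_attr_map g \o hfs_attr_map f].

Lemma hfs_comp_exists (R : realType) (U E V E' W E'' : Type)
    (g : hfs_mapping R V E' W E'') (f : hfs_mapping R U E V E') :
  exists k, is_hfs_comp g f k.
Proof.
exists (HFSMapping R (hfs_univ_map g \o hfs_univ_map f)
  (hfs_attr_map g \o hfs_attr_map f)); split=> // F c z /=.
apply: (hfe_bigcup_nested
  (f := fun i => (hfs_attr_map f i.1, hfs_univ_map f i.2))).
- by move=> i _; apply: hfe_sub01.
- by move=> [e x] [[/= te Ae] rx]; do 2!split => //=; exists e.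
- move=> [b y] [e x] [[/= tb _] ry]; split.
    by move=> [[/= qe Ae] px]; rewrite -qe -px in tb ry *.
  by move=> [[[/= _ Ae] _] [qe px]].
Qed.

Definition hfs_comp (R : realType) (U E V E' W E'' : Type)
    (g : hfs_mapping R V E' W E'') (f : hfs_mapping R U E V E') :
    hfs_mapping R U E W E'' :=
  sval (cid (hfs_comp_exists g f)).

Lemma hfs_compP (R : realType) (U E V E' W E'' : Type)
    (g : hfs_mapping R V E' W E'') (f : hfs_mapping R U E V E') :
  is_hfs_comp g f (hfs_comp g f).
Proof. exact: svalP (cid _). Qed.

(* Main.v *)
Require Import Defs.
From mathcomp Require Import all_boot all_order all_algebra.
From mathcomp Require Import all_classical all_reals.

(** Both sides send [F] to [h (g (f F))]: this is the defining property of a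
    composite, used twice on each side. On the left the inner composite is
    evaluated under [h], which needs [h] to be well defined on classes, that is,
    compatible with [hfs_eq] (lemma [hfs_apply_eq]). *)

Local Open Scope classical_set_scope.

Theorem theorem3p12 (R : realType) (U V W X E E' E'' E''' : Type)
  (U_neq0 : [set: U] !=set0) (V_neq0 : [set: V] !=set0)
  (W_neq0 : [set: W] !=set0) (X_neq0 : [set: X] !=set0)
  (E_neq0 : [set: E] !=set0) (E'_neq0 : [set: E'] !=set0)
  (E''_neq0 : [set: E''] !=set0) (E'''_neq0 : [set: E'''] !=set0)
  (f : hfs_mapping R U E V E') (g : hfs_mapping R V E' W E'')
  (h : hfs_mapping R W E'' X E''') :
  hfs_mapping_eq (hfs_comp h (hfs_comp g f)) (hfs_comp (hfs_comp h g) f).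
Proof.
move=> F b y.
have [-> _ _] := hfs_compP h (hfs_comp g f).
have [-> _ _] := hfs_compP (hfs_comp h g) f.
have [-> _ _] := hfs_compP h g.
(* [hfs_comp g f F] and [g (f F)] are only known to agree up to [hfs_eq], since
   their attribute sets are not compared; [h] respects this identification. *)
apply: hfs_apply_eq.
by have [gfE _ _] := hfs_compP g f; apply: gfE.
Qed.
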